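(* Let $G$ be a planar graph (embedded in the plane) with planar dual $\widehat G$. Then the graded Euler characteristic of the complex $\langle G\rangle$ recovers the chromatic polynomial $\chi_G$ of $G$: $$\chi_G\big((q+q^{-1})^2\big)=(q+q^{-1})^2\prod_{v}(q+q^{-1})^{(r(v)-2)/2}\;\chi_q\langle G\rangle ,$$ where the product is over all vertices $v$ of $\widehat G$ and $r(v)$ is the valence of $v$; the equality holds in the ring of formal Laurent series in $q$.
   Context: $\mathrm{Cob}(m)$ is Bar-Natan's dotted cobordism category over $R=\mathbb Z[\alpha]$ (relations: sphere $=0$, one-dotted sphere $=1$, two-dotted sphere $=0$, three-dotted sphere $=\alpha$, neck-cutting) and $\mathrm{Kom}(m)$ its category of bounded-below chain complexes. $P_2\in\mathrm{Kom}(2)$ is the complex $\mathbb 1\xrightarrow{s}qe_1\xrightarrow{x_{\mathrm{top}}-x_{\mathrm{bot}}}q^3e_1\xrightarrow{x_{\mathrm{top}}+x_{\mathrm{bot}}}q^5e_1\to\cdots$ (the last two maps alternating; $\mathbb 1$ two vertical strands in homological degree $0$, $e_1$ cap over cup, $s$ saddle, $x_{\mathrm{top}},x_{\mathrm{bot}}$ dots on the top/bottom arc, $q^{2n-1}e_1$ in homological degree $n$). For a graph $\Gamma$ embedded in the plane (loops and multiple edges allowed), the spin-network complex $S(\Gamma)\in\mathrm{Kom}(0)$ is obtained by replacing each edge by two parallel strands carrying a copy of $P_2$ and, near each vertex, joining the strand ends of cyclically consecutive edges by arcs, so that away from the projectors the strands form the boundary of a regular neighborhood of $\Gamma$. For a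 planar graph $G$, $\langle G\rangle:=S(\widehat G)$. The chromatic polynomial $\chi_G(Q)$ is the number of proper vertex colorings of $G$ with $Q$ colors (as a polynomial in $Q$; it vanishes if $G$ has a loop). The graded Euler characteristic is $\chi_q(C)=\sum_i(-1)^i[C_i]$, where a summand $q^j D$ with $D$ a diagram of $k$ circles contributes $q^j(q+q^{-1})^k$.
   Formalization: The graph G is assumed nonempty and connected: for disconnected G the formula fails (two isolated vertices give Q^2 on the left and Q on the right, with Q=(q+q^{-1})^2); the product over vertices is written as one power with the total exponent. *)

(* Defs.v *)
From HB Require Import structures.
From mathcomp Require Import all_boot all_order all_fingroup all_algebra.
Set Implicit Arguments. Unset Strict Implicit. Unset Printing Implicit Defensive.
Import Order.TTheory GRing.Theory Num.Theory.
Local Open Scope ring_scope.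

(* Formal Laurent series in q over Z.                                  *)
(* A series is q^(lval x) * sum_n (lcoef x n) q^n ; two series are      *)
(* equal (ls_eq) iff all their coefficients agree.                     *)
Record laurent := Laurent { lval : int; lcoef : nat -> int }.

Definition lcoefz (x : laurent) (m : int) : int :=
  if lval x <= m then lcoef x (absz (m - lval x)) else 0.

Definition ls_eq (x y : laurent) : Prop := forall m : int, lcoefz x m = lcoefz y m.

Definition ls_const (c : int) : laurent :=
  Laurent 0 (fun n => if n == 0%N then c else 0).
Definition ls_zero : laurent := ls_const 0.
Definition ls_one : laurent := ls_const 1.
Definition ls_mono (k : int) : laurent :=
  Laurent k (fun n => if n == 0%N then 1 else 0).

Definition ls_add (x y : laurent) : laurent :=
  let v := Order.min (lval x) (lval y) in
  Laurent v (fun n => lcoefz x (v + n%:Z) + lcoefz y (v + n%:Z)).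

Definition ls_mul (x y : laurent) : laurent :=
  Laurent (lval x + lval y)
    (fun n => \sum_(i < n.+1) lcoef x i * lcoef y (n - i)%N).

Definition ls_exp (x : laurent) (n : nat) : laurent := iter n (ls_mul x) ls_one.

Definition ls_sum (s : seq laurent) : laurent := foldr ls_add ls_zero s.

Definition qint2 : laurent := ls_add (ls_mono (-1)) (ls_mono 1).

(* its inverse in the Laurent series ring: q/(1+q^2) = q - q^3 + q^5 - ... *)
Definition qint2_inv : laurent :=
  Laurent 1 (fun n => if odd n then 0 else (-1) ^+ n./2).

Definition qint2_powz (z : int) : laurent :=
  match z with
  | Posz n => ls_exp qint2 n
  | Negz n => ls_exp qint2_inv n.+1
  end.

Definition ls_horner (p : {poly int}) (x : laurent) : laurent :=
  foldr (fun c acc => ls_add (ls_const c) (ls_mul x acc)) ls_zero p.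

(* Graded Euler characteristic of a bounded-below complex in Kom(0).   *)
(* The complex is recorded by its chain objects: C i is the list of     *)
(* summands q^j D of the object in homological degree i, each given as  *)
(* (j, k) with k the number of circles of D.  A summand contributes     *)
(* q^j (q+q^{-1})^k.  chi_q(C) = sum_i (-1)^i [C_i] is the q-adic limit *)
(* of the partial sums.                                                 *)
Definition summand_char (jk : int * nat) : laurent :=
  ls_mul (ls_mono jk.1) (ls_exp qint2 jk.2).

Definition euler_partial (C : nat -> seq (int * nat)) (N : nat) : laurent :=
  ls_sum [seq ls_mul (ls_const ((-1) ^+ i)) (ls_sum (map summand_char (C i)))
         | i <- iota 0 N.+1].

Definition is_euler_char (C : nat -> seq (int * nat)) (X : laurent) : Prop :=
  forall m : int, exists N0 : nat, forall N : nat, (N0 <= N)%N ->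
    lcoefz X m = lcoefz (euler_partial C N) m.

(* Embedded graphs as combinatorial maps.                               *)
(* Darts D; alpha : fixed-point-free involution (the two half-edges of  *)
(* an edge); vert : D -> V assigns to a dart its vertex; sigma : the    *)
(* rotation (cyclic order of darts around each vertex).                 *)
Definition fpf_involution (D : finType) (alpha : {perm D}) : Prop :=
  forall d, alpha (alpha d) = d /\ alpha d != d.

Definition is_rotation (V D : finType) (vert : D -> V) (sigma : {perm D}) : Prop :=
  forall d d', (vert d == vert d') = fconnect sigma d d'.

Definition graph_adj (V D : finType) (vert : D -> V) (alpha : {perm D}) : rel V :=
  [rel x y | [exists d, (vert d == x) && (vert (alpha d) == y)]].

Definition graph_connected (V D : finType) (vert : D -> V) (alpha : {perm D}) : Prop :=
  (0 < #|V|)%N /\ forall x y : V, connect (graph_adj vert alpha) x y.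

Definition face_perm (D : finType) (sigma alpha : {perm D}) : {perm D} :=
  (alpha * sigma)%g.

(* number of faces of a connected embedded graph (an edgeless connected
   graph, i.e. a single vertex, has one face) *)
Definition nfaces (D : finType) (sigma alpha : {perm D}) : nat :=
  if #|D| == 0%N then 1%N else #|porbits (face_perm sigma alpha)|.

Definition nedges (D : finType) (alpha : {perm D}) : nat := #|porbits alpha|.

(* genus 0: the embedding is in the plane (sphere) *)
Definition plane_embedded (V D : finType) (sigma alpha : {perm D}) : Prop :=
  (#|V|%:Z - (nedges alpha)%:Z + (nfaces sigma alpha)%:Z = 2).

(* (W, wvert, tau, alpha) is the planar dual of (V, vert, sigma, alpha):
   same darts/edges, vertices = faces of G, rotation = face permutation *)
Definition is_planar_dual (V W D : finType) (sigma alpha : {perm D})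
    (wvert : D -> W) (tau : {perm D}) : Prop :=
  [/\ tau = face_perm sigma alpha, is_rotation wvert tau
    & #|W| = nfaces sigma alpha].

Definition proper_colorings (V D : finType) (vert : D -> V) (alpha : {perm D})
    (k : nat) : nat :=
  #|[set c : {ffun V -> 'I_k} | [forall d, c (vert d) != c (vert (alpha d))]]|.

(* The spin-network complex S(Gamma) of an embedded graph               *)
(* Gamma = (W, wvert, tau, alpha); we record its chain objects.         *)
Inductive tl2 := TLid | TLe1.

(* chain object of P_2 in homological degree n: (q-shift, diagram) *)
Definition P2_obj (n : nat) : int * tl2 :=
  if n is 0 then (0, TLid) else ((n.*2.-1)%:Z, TLe1).

Section SpinNetwork.
Variables (W D : finType) (wvert : D -> W) (tau alpha : {perm D}).

Definition edges_of : {set {set D}} := porbits alpha.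

(* strand endpoints: each dart has a left (false) and a right (true)
   strand next to it.  Near a vertex, arcs join the left strand of d to
   the right strand of the next dart tau d. *)
Definition corner_match (x : D * bool) : D * bool :=
  if x.2 then ((tau^-1)%g x.1, false) else (tau x.1, true).

(* along an edge carrying 1: two parallel strands; carrying e_1:
   cap over cup *)
Definition edge_match (st : {set D} -> tl2) (x : D * bool) : D * bool :=
  match st (porbit alpha x.1) with
  | TLid => (alpha x.1, ~~ x.2)
  | TLe1 => (x.1, ~~ x.2)
  end.

Definition strand_rel (st : {set D} -> tl2) : rel (D * bool) :=
  [rel x y | (y == corner_match x) || (y == edge_match st x)].

(* number of circles of the resulting closed diagram: connected
   components of the strands, plus one circle for each isolated vertex *)
Definition ncircles (st : {set D} -> tl2) : nat :=
  #|[set [set y | connect (strand_rel st) x y] | x : D * bool]|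
  + #|[set w : W | [forall d, wvert d != w]]|.

(* homological degree assignments to the copies of P_2 (one per edge)
   of total degree i *)
Definition degree_states (i : nat) : seq {ffun {set D} -> 'I_i.+1} :=
  enum [set n : {ffun {set D} -> 'I_i.+1}
     | [forall e, (e \notin edges_of) ==> (val (n e) == 0%N)]
       && (\sum_(e in edges_of) val (n e) == i)%N].

Definition state_shift (i : nat) (n : {ffun {set D} -> 'I_i.+1}) : int :=
  \sum_(e in edges_of) (P2_obj (val (n e))).1.

Definition state_diagram (i : nat) (n : {ffun {set D} -> 'I_i.+1}) : {set D} -> tl2 :=
  fun e => (P2_obj (val (n e))).2.

Definition spin_chain (i : nat) : seq (int * nat) :=
  [seq (state_shift n, ncircles (state_diagram n)) | n <- degree_states i].

Definition valence (w : W) : nat := #|[set d | wvert d == w]|.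

End SpinNetwork.

(* Main.v *)
(* Expanding every copy of P_2 as 1 - e_1/[2], with [2] = q + q^-1, turns the
   Euler characteristic into the sum over edge sets B (the edges carrying e_1)
   of (-1)^|B| [2]^(f(B) - |B|), where f(B) is the number of circles.  These
   circles bound a ribbon neighbourhood of the subgraph (V, B) of G, so they are
   the cycles of the permutation obtained from sigma by composing with alpha on
   the darts of B.  The quantity 2 k(B) - |V| + |B| - f(B), with k(B) the number
   of components of (V, B), does not decrease when an edge is added; it vanishes
   for B empty, and for B = E by planarity, hence always.  So the sum is
   [2]^(-|V|) times the Whitney expansion of chi_G at [2]^2.

   Laurent series are compared through integer polynomials modulo powers of X,
   which makes the infinite sums finite: (1 + X^2)(X - X^3 + ...) is congruent
   to X. *)
Require Import Defs.
From HB Require Import structures.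
From mathcomp Require Import all_boot all_order all_fingroup all_algebra.
From mathcomp Require Import zify ring.
Set Implicit Arguments. Unset Strict Implicit. Unset Printing Implicit Defensive.
Import Order.TTheory GRing.Theory Num.Theory.
Local Open Scope ring_scope.

(** * Permutations and components *)

(** Both images are projections of the set of pairs [(f x, g x)], and the hypothesis makes the first
    projection injective there. It compares class counts taken through different representatives. *)
Lemma leq_card_imset_kernel (T U U' : finType) (f : T -> U) (g : T -> U') (A : {set T}) :
  {in A &, forall x y, f x = f y -> g x = g y} -> (#|g @: A| <= #|f @: A|)%N.
Proof.
move=> fg; pose P := [set (f x, g x) | x in A].
have -> : g @: A = snd @: P by rewrite -imset_comp.
have -> : f @: A = fst @: P by rewrite -imset_comp.
rewrite (card_in_imset (f := fst)) ?leq_imset_card //.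
move=> _ _ /imsetP[x xA ->] /imsetP[y yA ->] /= fxy.
by rewrite fxy (fg x y).
Qed.

Lemma eq_card_imset_kernel (T U U' : finType) (f : T -> U) (g : T -> U') (A : {set T}) :
  {in A &, forall x y, f x = f y <-> g x = g y} -> #|f @: A| = #|g @: A|.
Proof.
move=> fg; apply/eqP; rewrite eqn_leq !leq_card_imset_kernel //.
  by move=> x y xA yA /fg->.
by move=> x y xA yA /fg->.
Qed.

Lemma porbit_step (T : finType) (s : {perm T}) x : porbit s (s x) = porbit s x.
Proof. exact: (porbit_perm s 1). Qed.

Lemma eq_in_porbit (T : finType) (U : eqType) (s : {perm T}) (f : T -> U) :
  (forall z, f (s z) = f z) -> forall x y, x \in porbit s y -> f x = f y.
Proof.
move=> fs x y /porbitP[i ->]; elim: i => [|i IH]; first by rewrite perm1.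
by rewrite expgSr permM fs.
Qed.

(** The map [s] intertwines the two products, [s ((s * t) x) = (t * s) (s x)], so it carries cycles
    of one onto cycles of the other. *)
Lemma card_porbits_mulC (T : finType) (s t : {perm T}) :
  #|porbits (s * t)| = #|porbits (t * s)|.
Proof.
rewrite /porbits.
have -> : porbit (t * s) @: T = (porbit (t * s) \o s) @: [set: T].
  apply/setP => X; apply/imsetP/imsetP => -[x _ ->].
    by exists (s^-1%g x); rewrite //= permKV.
  by exists (s x).
have -> : porbit (s * t) @: T = porbit (s * t) @: [set: T].
  by apply/setP => X; apply/imsetP/imsetP => -[x _ ->]; exists x.
apply: eq_card_imset_kernel => x y _ _ /=; split => /eqP; rewrite eq_porbit_mem => xy.
  apply: (eq_in_porbit (s := (s * t)%g) (f := fun z => porbit (t * s) (s z))) xy => z.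
  by rewrite permM -[LHS]/(porbit _ (s (t (s z)))) -permM porbit_step.
have /= := eq_in_porbit (s := (t * s)%g) (f := fun z => porbit (s * t) (s^-1%g z)) _ xy.
rewrite !permK; apply => z.
by rewrite permM permK -[in RHS]porbit_step permM permKV.
Qed.

Section Components.
Variable T : finType.
Implicit Type e : rel T.

Definition ncomp e : nat := #|fingraph.root e @: [set: T]|.

Lemma ncomp_le e : (ncomp e <= #|T|)%N.
Proof. by rewrite (leq_trans (leq_imset_card _ _)) ?cardsT. Qed.

Lemma ncomp_discrete e : (forall x y, e x y -> x = y) -> ncomp e = #|T|.
Proof.
move=> e0; have idc x y : connect e x y -> x = y.
  by case/connectP=> p; elim: p x => [|z p IH] x //= /andP[/e0-> /IH].
rewrite /ncomp card_in_imset ?cardsT // => x y _ _ xy.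
by rewrite (idc _ _ (connect_root e x)) xy -(idc _ _ (connect_root e y)).
Qed.

Lemma ncomp_connected e (x0 : T) : connect_sym e ->
  (forall x y, connect e x y) -> ncomp e = 1%N.
Proof.
move=> se ec; rewrite /ncomp -(cards1 (fingraph.root e x0)); congr #|pred_of_set _|.
apply/setP=> y; rewrite inE; apply/imsetP/eqP => [[x _ ->]|->]; last by exists x0.
exact/fingraph.rootP.
Qed.

Section AddEdge.
Variables (e e' : rel T) (u v : T).
Hypotheses (se : connect_sym e) (se' : connect_sym e').
Hypothesis ee' : forall x y, e' x y -> [|| e x y, (x == u) && (y == v) | (x == v) && (y == u)].

Let E x := connect e x u || connect e x v.

(** Induction along an [e']-path: [E] is stable under [e], and a step outside [e] has both ends in
    [E]. *)
Lemma connect_add_edge x y : connect e' x y -> connect e x y || (E x && E y).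
Proof.
case/connectP=> p; elim: p x => [|z p IH] x /=; first by move=> _ ->; rewrite connect0.
case/andP=> /ee' xz /IH{}IH /IH{IH} IH.
case/or3P: xz => [xz | /andP[/eqP-> /eqP zv] | /andP[/eqP-> /eqP zu]].
- have cxz := connect1 xz.
  by rewrite /E !(same_connect se cxz).
- have -> : E u by rewrite /E connect0.
  case/orP: IH => [|/andP[_ ->]]; last by rewrite orbT.
  by rewrite zv /E [connect e y v]se => ->; rewrite !orbT.
- have -> : E v by rewrite /E connect0 orbT.
  case/orP: IH => [|/andP[_ ->]]; last by rewrite orbT.
  by rewrite zu /E [connect e y u]se => ->; rewrite !orbT.
Qed.

(** With [u] and [v] already connected, [E] is a single component of [e], so the extra edge merges
    nothing. *)
Lemma ncomp_add_edge_connected : connect e u v -> (ncomp e <= ncomp e')%N.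
Proof.
move=> uv; apply: leq_card_imset_kernel => x y _ _ /(fingraph.rootP se') /connect_add_edge.
case/orP => [/(fingraph.rootP se) //|/andP[]]; rewrite /E.
rewrite -!(same_connect_r se uv) !orbb => xu yu.
by apply/(fingraph.rootP se); rewrite (same_connect se xu) se.
Qed.

(** Only the components of [u] and [v] can merge: once that of [v] is discarded, [e'] still
    separates the others. *)
Lemma ncomp_add_edge : (ncomp e <= (ncomp e').+1)%N.
Proof.
pose A := [set x | ~~ connect e x v].
have -> : ncomp e = #|fingraph.root e @: A|.+1.
  have -> : #|fingraph.root e @: A|.+1 = #|fingraph.root e v |: fingraph.root e @: A|.
    rewrite cardsU1; case: imsetP => // -[x]; rewrite inE => xv vx.
    by case/negP: xv; rewrite se; apply/(fingraph.rootP se).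
  congr #|pred_of_set _|; apply/setP=> z; rewrite !inE.
  apply/imsetP/orP => [[x _ ->]|[/eqP->|/imsetP[x _ ->]]]; [|by exists v|by exists x].
  case: (boolP (connect e x v)) => xv; first by left; apply/eqP/(fingraph.rootP se).
  by right; apply: imset_f; rewrite inE.
rewrite ltnS.
apply: (@leq_trans #|fingraph.root e' @: A|);
  last by apply/subset_leq_card/imsetS/subsetP=> x; rewrite !inE.
apply: leq_card_imset_kernel => x y; rewrite !inE => xv yv /(fingraph.rootP se') /connect_add_edge.
rewrite /E (negbTE xv) (negbTE yv) !orbF.
case/orP => [/(fingraph.rootP se) //|/andP[xu yu]].
by apply/(fingraph.rootP se); rewrite (same_connect se xu) se.
Qed.
End AddEdge.
End Components.

(** * Subgraphs of an embedded graph *)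

Section EdgeFlip.
Variables (D : finType) (alpha : {perm D}).
Hypothesis alphaI : fpf_involution alpha.
Implicit Types (A B : {set {set D}}) (d x : D).

Let alphaK d : alpha (alpha d) = d. Proof. by case: (alphaI d). Qed.

Definition flip_fun B d := if porbit alpha d \in B then alpha d else d.

Lemma flip_funK B : involutive (flip_fun B).
Proof.
move=> d; rewrite /flip_fun; case dB: (porbit alpha d \in B); last by rewrite dB.
by rewrite porbit_step dB alphaK.
Qed.

Definition flip B : {perm D} := perm (inv_inj (flip_funK B)).

Lemma flipE B d : flip B d = if porbit alpha d \in B then alpha d else d.
Proof. by rewrite permE. Qed.

Lemma flipK B d : flip B (flip B d) = d.
Proof. by rewrite !permE flip_funK. Qed.

Lemma flip0 : flip set0 = 1%g.
Proof. by apply/permP=> d; rewrite flipE inE perm1. Qed.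

Lemma flip_all : flip (porbits alpha) = alpha.
Proof. by apply/permP=> d; rewrite flipE imset_f. Qed.

(** This passes from the dual graph to [G]: the edges carrying the identity form the complement of
    those carrying [e_1], and the factor [alpha] in the face permutation exchanges the two sets. *)
Lemma flip_compl A B : (forall d, (porbit alpha d \in A) = (porbit alpha d \notin B)) ->
  (flip A * alpha)%g = flip B.
Proof.
move=> AB; apply/permP=> d; rewrite permM !flipE AB.
by case: (_ \in B); rewrite /= ?alphaK.
Qed.

Lemma porbit_edge x : porbit alpha x = [set x; alpha x].
Proof.
apply/setP=> y; rewrite !inE; apply/idP/orP => [|[]/eqP->]; last 2 first.
- exact: porbit_id.
- exact: (mem_porbit alpha 1).
case/porbitP=> i ->; elim: i => [|i]; first by rewrite perm1; left.
by rewrite expgSr permM => -[/eqP->|/eqP->]; rewrite ?alphaK; [right|left].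
Qed.

Lemma flip_add B x : porbit alpha x \notin B ->
  flip (porbit alpha x |: B) = (tperm x (alpha x) * flip B)%g.
Proof.
move=> xB; apply/permP=> d; rewrite permM.
case: tpermP => [->|->|/eqP dx /eqP dax].
- by rewrite !flipE porbit_step !inE eqxx (negbTE xB).
- by rewrite !flipE porbit_step !inE eqxx (negbTE xB) alphaK.
- by rewrite !flipE !inE eq_porbit_mem porbit_edge !inE (negbTE dx) (negbTE dax).
Qed.

Lemma card_darts : #|D| = (2 * nedges alpha)%N.
Proof.
rewrite -cardsT mulnC; apply: card_uniform_partition.
  move=> _ /imsetP[x _ ->]; rewrite porbit_edge cards2.
  by case: (alphaI x) => _; rewrite eq_sym => ->.
apply/and3P; split.
- rewrite eqEsubset subsetT; apply/subsetP=> x _.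
  by apply/bigcupP; exists (porbit alpha x); [apply: imset_f|apply: porbit_id].
- apply/trivIsetP=> _ _ /imsetP[x _ ->] /imsetP[y _ ->].
  apply: contraR => /pred0Pn[z /andP[/= zx zy]].
  by rewrite -!eq_porbit_mem in zx zy; rewrite -(eqP zx) (eqP zy).
- by apply/imsetP=> -[x _ /setP/(_ x)]; rewrite inE porbit_id.
Qed.

(** * Components and boundary cycles of an edge subset *)

Section Subgraph.
Variables (V : finType) (vert : D -> V).

Definition sub_adj B : rel V :=
  [rel x y | [exists d, [&& porbit alpha d \in B, vert d == x & vert (alpha d) == y]]].

Definition kcomp B : nat := ncomp (sub_adj B).

Lemma sub_adj_sym B : connect_sym (sub_adj B).
Proof.
apply: sym_connect_sym => x y; apply/existsP/existsP => -[d /and3P[dB dx dy]];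
by exists (alpha d); rewrite porbit_step alphaK dB dx dy.
Qed.

Lemma sub_adj_flip B d : connect (sub_adj B) (vert d) (vert (flip B d)).
Proof.
rewrite flipE; case: ifP => dB //; apply: connect1.
by apply/existsP; exists d; rewrite dB !eqxx.
Qed.

Lemma sub_adj_add B x u v : sub_adj (porbit alpha x |: B) u v ->
  [|| sub_adj B u v, (u == vert x) && (v == vert (alpha x))
    | (u == vert (alpha x)) && (v == vert x)].
Proof.
case/existsP=> d /and3P[]; rewrite !inE => /orP[|dB] /eqP.
  move/eqP; rewrite eq_porbit_mem porbit_edge !inE => /orP[]/eqP-> /eqP<- /eqP<-;
  by rewrite ?alphaK !eqxx !orbT.
by move=> du dv; apply/orP; left; apply/existsP; exists d; rewrite dB du eqxx.
Qed.

Lemma kcomp0 : kcomp set0 = #|V|.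
Proof.
by apply: ncomp_discrete => x y /existsP[d]; rewrite inE.
Qed.

Lemma kcomp_all : graph_connected vert alpha -> kcomp (porbits alpha) = 1%N.
Proof.
case=> /card_gt0P[x0 _] gc; apply: ncomp_connected => //; first exact: sub_adj_sym.
move=> x y; rewrite (eq_connect (e' := graph_adj vert alpha)) // => u v.
by apply: eq_existsb => d; rewrite imset_f.
Qed.

Section Boundary.
Variable sigma : {perm D}.
Hypothesis vert_sigma : forall d, vert (sigma d) = vert d.

(** The cycles trace the boundary of the ribbon neighbourhood of the subgraph with edge set [B]:
    cross an edge of [B], then turn at the vertex. *)
Definition nbound B : nat := #|porbits (flip B * sigma)|.

(* Adding the edge {x, alpha x} multiplies the boundary permutation by a
   transposition, which merges two cycles unless x and alpha x lie on a common
   cycle; in that case the ends of the edge were already connected. *)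
Lemma defect_add B x : porbit alpha x \notin B ->
  (2 * kcomp B + #|B| + nbound (porbit alpha x |: B)
   <= 2 * kcomp (porbit alpha x |: B) + #|porbit alpha x |: B| + nbound B)%N.
Proof.
move=> xB; have := porbits_mul_tperm (flip B * sigma) x (alpha x).
rewrite /= mulgA -flip_add // -!/(nbound _) cardsU1 xB.
have -> : x != alpha x by case: (alphaI x); rewrite eq_sym.
have add_xB := @sub_adj_add B x.
case: (boolP (x \in _)) => xax /=; last first.
  have := ncomp_add_edge (sub_adj_sym B) (sub_adj_sym _) add_xB.
  rewrite -!/(kcomp _) -addnn; move: #|B| => b; lia.
(* A boundary cycle never leaves its component: [sigma] fixes the vertex, and [flip B] moves along
   an edge of [B]. *)
have cx : connect (sub_adj B) (vert x) (vert (alpha x)).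
  apply/(fingraph.rootP (sub_adj_sym B)).
  apply: (eq_in_porbit (s := (flip B * sigma)%g)
            (f := fun d => fingraph.root (sub_adj B) (vert d))) xax => d.
  rewrite permM vert_sigma; apply/(fingraph.rootP (sub_adj_sym B)).
  by rewrite sub_adj_sym sub_adj_flip.
have := ncomp_add_edge_connected (sub_adj_sym B) (sub_adj_sym _) add_xB cx.
rewrite -!/(kcomp _) -addnn; move: #|B| => b; lia.
Qed.

Lemma defect_mono B B' : B \subset B' -> B' \subset porbits alpha ->
  (2 * kcomp B + #|B| + nbound B' <= 2 * kcomp B' + #|B'| + nbound B)%N.
Proof.
move En: #|B' :\: B| => n; elim: n B En => [|n IH] B En sB sE.
  have -> // : B = B'; apply/eqP; rewrite eqEsubset sB -setD_eq0 -cards_eq0.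
  exact/eqP.
have /card_gt0P[e] : (0 < #|B' :\: B|)%N by rewrite En.
rewrite inE => /andP[eB eB'].
have /imsetP[x _ Ee] := subsetP sE e eB'; rewrite Ee in eB eB'.
have sB1 : porbit alpha x |: B \subset B' by rewrite subUset sub1set eB' sB.
have En1 : #|B' :\: (porbit alpha x |: B)| = n.
  apply: succn_inj; rewrite -En (cardsD1 (porbit alpha x) (B' :\: B)) inE eB eB'.
  by rewrite setDDl setUC.
have := IH _ En1 sB1 sE; have := defect_add eB.
move: #|B| #|B'| #|_ |: B| => b b' b1; lia.
Qed.

(** A squeeze: [2 * kcomp B + #|B| - nbound B] is monotone in [B] and equals [#|V|] both for the
    empty set and, by Euler's formula, for all edges. *)
Lemma nboundE B : graph_connected vert alpha -> B \subset porbits alpha ->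
  nbound set0 = #|V| -> (nbound (porbits alpha) + #|V| = nedges alpha + 2)%N ->
  (nbound B + #|V| = #|B| + 2 * kcomp B)%N.
Proof.
move=> gc sB n0 nE.
have := defect_mono sB (subxx _); have := defect_mono (sub0set B) sB.
rewrite kcomp0 kcomp_all // cards0 n0; move: nE; rewrite /nedges.
move: #|B| #|porbits alpha| #|V| => b a v; lia.
Qed.

End Boundary.
End Subgraph.
End EdgeFlip.

(** * Circles of the state diagrams *)

Section Circles.
Variables (D : finType) (tau alpha : {perm D}).
Hypothesis alphaI : fpf_involution alpha.
Variables (st : {set D} -> tl2) (A : {set {set D}}).
Hypothesis stA : forall d,
  (porbit alpha d \in A) = (if st (porbit alpha d) is TLid then true else false).

Let fA := flip alphaI A.
Let bnd := (tau * fA)%g.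

Lemma edge_match_flip x : edge_match alpha st x = (fA x.1, ~~ x.2).
Proof. by rewrite /edge_match flipE stA; case: (st _). Qed.

Lemma corner_matchK : involutive (corner_match tau).
Proof. by case=> d []; rewrite /corner_match /= ?permKV ?permK. Qed.

Lemma edge_matchK : involutive (edge_match alpha st).
Proof. by case=> d b; rewrite !edge_match_flip /= flipK negbK. Qed.

Lemma strand_rel_sym : connect_sym (strand_rel tau alpha st).
Proof.
apply: sym_connect_sym => x y; rewrite /strand_rel /=.
by rewrite ![y == _]eq_sym (can2_eq corner_matchK corner_matchK)
           (can2_eq edge_matchK edge_matchK).
Qed.

(** Corner arcs pair each right endpoint with one left endpoint; its dart serves as the
    representative of both. *)
Let dart (x : D * bool) : D := if x.2 then (tau^-1)%g x.1 else x.1.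

Lemma connect_dart x : connect (strand_rel tau alpha st) x (dart x, false).
Proof.
case: x => d []; rewrite /dart //=.
by apply: connect1; rewrite /strand_rel /= /corner_match /= eqxx.
Qed.

(** A corner arc keeps the representative dart; a strand along an edge moves it by one step of
    [bnd], forwards from a right endpoint and backwards from a left one. *)
Lemma strand_dart x y : strand_rel tau alpha st x y ->
  porbit bnd (dart x) = porbit bnd (dart y).
Proof.
rewrite /strand_rel /= edge_match_flip => /orP[]/eqP->; case: x => d [];
  rewrite /dart /corner_match //=.
- by rewrite permK.
- by rewrite -porbit_step permM permKV.
- by rewrite -[RHS]porbit_step permM permKV flipK.
Qed.

(** One step of [bnd] from [z] is the corner arc to [(tau z, true)] followed by the strand along
    that edge. *)
Lemma connect_bnd d d' : d \in porbit bnd d' ->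
  connect (strand_rel tau alpha st) (d, false) (d', false).
Proof.
case/porbitP=> i ->; elim: i => [|i IH]; first by rewrite perm1 connect0.
apply: connect_trans IH; rewrite expgSr permM; move: ((bnd ^+ i)%g d') => z.
rewrite strand_rel_sym; apply: (@connect_trans _ _ (tau z, true)); apply: connect1.
  by rewrite /strand_rel /= /corner_match /= eqxx.
by rewrite /strand_rel /= edge_match_flip /= permM eqxx orbT.
Qed.

Lemma card_strand_comp :
  #|[set [set y | connect (strand_rel tau alpha st) x y] | x : D * bool]|
  = #|porbits bnd|.
Proof.
have -> : porbits bnd = (porbit bnd \o dart) @: [set: D * bool].
  apply/setP=> X; apply/imsetP/imsetP => -[x _ ->]; last by exists (dart x).
  by exists (x, false).
have -> : [set [set y | connect (strand_rel tau alpha st) x y] | x : D * bool]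
        = [set [set y | connect (strand_rel tau alpha st) x y] | x in [set: D * bool]].
  by apply/setP=> X; apply/imsetP/imsetP => -[x _ ->]; exists x.
apply: eq_card_imset_kernel => x y _ _; split=> /= [/setP/(_ y)|/eqP].
  rewrite !inE connect0 => /connectP[p]; elim: p x => [|z p IH] x /=; first by move=> _ ->.
  by case/andP=> /strand_dart-> /IH{}IH /IH.
rewrite eq_porbit_mem => /connect_bnd xy; apply/setP=> z; rewrite !inE.
apply: (same_connect strand_rel_sym).
apply: connect_trans (connect_dart x) (connect_trans xy _).
by rewrite strand_rel_sym connect_dart.
Qed.

End Circles.

(** * Circle counts for the plane dual, and the exponent of the prefactor *)

Lemma porbit_fconnect (T : finType) (s : {perm T}) x y :
  (x \in porbit s y) = fconnect s x y.
Proof.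
rewrite porbit_sym; apply/porbitP/idP => [[i ->]|/iter_findex<-].
  by rewrite permX fconnect_iter.
by exists (findex s x y); rewrite permX.
Qed.

Lemma card_porbits_rotation (V D : finType) (vert : D -> V) (sigma : {perm D}) :
  is_rotation vert sigma -> #|porbits sigma| = #|vert @: [set: D]|.
Proof.
move=> rot; have -> : porbits sigma = porbit sigma @: [set: D].
  by apply/setP=> X; apply/imsetP/imsetP => -[x _ ->]; exists x.
apply: eq_card_imset_kernel => x y _ _; split => /eqP.
  by rewrite eq_porbit_mem porbit_fconnect -rot => /eqP.
by rewrite rot -porbit_fconnect -eq_porbit_mem => /eqP.
Qed.

Lemma rotation_vert (V D : finType) (vert : D -> V) (sigma : {perm D}) :
  is_rotation vert sigma -> forall d, vert (sigma d) = vert d.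
Proof. by move=> rot d; apply/eqP; rewrite eq_sym rot fconnect1. Qed.

Lemma connected_vert_onto (V D : finType) (vert : D -> V) (alpha : {perm D}) (d0 : D) :
  graph_connected vert alpha -> vert @: [set: D] = [set: V].
Proof.
case=> _ gc; apply/setP=> x; rewrite inE; apply/imsetP.
case/connectP: (gc x (vert d0)) => -[|y p] /=; first by move=> _ <-; exists d0.
by case/andP=> /existsP[d /andP[/eqP<- _]] _ _; exists d.
Qed.

Section PlaneCircles.
Variables (V W D : finType) (vert : D -> V) (sigma alpha : {perm D}).
Variables (wvert : D -> W) (tau : {perm D}).
Hypothesis alphaI : fpf_involution alpha.
Hypothesis rot : is_rotation vert sigma.
Hypothesis conn : graph_connected vert alpha.
Hypothesis plane : plane_embedded V sigma alpha.
Hypothesis dual : is_planar_dual V sigma alpha wvert tau.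

Lemma ncircles_plane (st : {set D} -> tl2) (B : {set {set D}}) :
  B \subset porbits alpha ->
  (forall d, (porbit alpha d \in B) = (if st (porbit alpha d) is TLe1 then true else false)) ->
  (ncircles wvert tau alpha st + #|V| = #|B| + 2 * kcomp alpha vert B)%N.
Proof.
move=> sB stB; case: dual => tauE wrot cW.
pose A := ~: B.
have stA d : (porbit alpha d \in A) = (if st (porbit alpha d) is TLid then true else false).
  by rewrite inE stB; case: (st _).
(* After the cyclic swap the permutation is [flip A * alpha * sigma], that is [flip B * sigma]: the
   circles drawn on the dual are boundary cycles of the subgraph [B] of [G]. *)
rewrite /ncircles (card_strand_comp tau alphaI stA) card_porbits_mulC tauE /face_perm mulgA.
rewrite (@flip_compl _ _ alphaI _ B) => [|d]; last by rewrite inE.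
have k1 := kcomp_all alphaI conn.
case: (pickP D) => [d0 _|D0].
  have nD : (#|D| == 0%N) = false by apply/eqP=> /card0_eq/(_ d0).
  (* No dual vertex is isolated: [wvert] takes as many values as there are faces, which is
     [#|W|]. *)
  have -> : #|[set w : W | [forall d, wvert d != w]]| = 0%N.
    apply/eqP; rewrite cards_eq0; apply/eqP/setP=> w; rewrite !inE; apply/negP=> /forallP nw.
    have : wvert @: [set: D] = [set: W].
      apply/eqP; rewrite eqEcard subsetT /= cardsT cW /nfaces nD.
      by rewrite -(card_porbits_rotation wrot) tauE.
    move/setP/(_ w); rewrite inE => /imsetP[d _ wd].
    by move: (nw d); rewrite wd eqxx.
  rewrite addn0 -/(nbound alphaI sigma B); apply: nboundE => //.
  - exact: rotation_vert rot.
  - by rewrite /nbound flip0 mul1g (card_porbits_rotation rot) (connected_vert_onto d0 conn) cardsT.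
  - move: plane; rewrite /plane_embedded /nfaces nD /nbound flip_all /face_perm.
    move: #|V| #|porbits _| (nedges _) => v f e; lia.
(* Without darts, [V] and [W] are single points, and the only circle is the one contributed by the
   isolated vertex of [W]. *)
have E0 : porbits alpha = set0.
  by apply/setP=> X; rewrite inE; apply/imsetP=> -[x]; have := D0 x.
have B0 : B = set0 by apply/eqP; rewrite -subset0 -E0.
have V1 : #|V| = 1%N by rewrite -k1 E0 kcomp0.
rewrite B0 kcomp0 cards0 V1.
have -> : porbits (flip alphaI set0 * sigma) = set0.
  by apply/setP=> X; rewrite inE; apply/imsetP=> -[x]; have := D0 x.
rewrite cards0; have -> : [set w : W | [forall d, wvert d != w]] = [set: W].
  by apply/setP=> w; rewrite !inE; apply/forallP=> d; have := D0 d.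
by rewrite cardsT cW /nfaces (_ : #|D| == 0%N) //; apply/eqP/eq_card0.
Qed.

(** The valences add up to twice the number of edges, so the sum is even and the division exact,
    although a single [(r(v) - 2) / 2] may be a half-integer. Euler's formula then gives [#|V|]. *)
Lemma prefactor_exponent :
  2 + ((\sum_(w : W) ((valence wvert w)%:Z - 2)) %/ 2)%Z = #|V|%:Z.
Proof.
case: dual => _ _ cW.
rewrite big_split /= sumr_const -(big_morph Posz PoszD (erefl _)).
have -> : (\sum_(w : W) valence wvert w)%N = #|D|.
  rewrite -sum1_card (partition_big wvert predT) //=; apply: eq_bigr => w _.
  by rewrite /valence -sum1_card; apply: eq_bigl => d; rewrite inE.
rewrite (card_darts alphaI) cW; move: plane; rewrite /plane_embedded.
move: (nedges _) (nfaces _ _) #|V| => e f v; lia.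
Qed.

End PlaneCircles.

(** * The Whitney expansion *)

Lemma prod_subset_expand (R : comNzRingType) (I : finType) (S : {set I}) (F : I -> R) :
  \prod_(i in S) (1 - F i) = \sum_(B : {set I} | B \subset S) (-1) ^+ #|B| * \prod_(i in B) F i.
Proof.
rewrite big_mkcond /=.
(* The product is extended to all of [I] with a zero first term outside [S], which kills every
   subset not contained in [S]. *)
rewrite (eq_bigr (fun i => (if i \in S then - F i else 0) + 1)); last first.
  by move=> i _; case: ifP; rewrite ?add0r // addrC.
rewrite bigA_distr [RHS]big_mkcond; apply: eq_bigr => B _.
rewrite -big_mkcond /=; case: ifP => [sB|/negbT].
  rewrite (eq_bigr (fun i => - F i)) => [|i iB]; last by rewrite (subsetP sB).
  by rewrite prodrN.
by case/subsetPn=> i iB iS; rewrite (bigD1 i) //= (negbTE iS) mul0r.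
Qed.

Section Chromatic.
Variables (V D : finType) (vert : D -> V) (alpha : {perm D}).
Hypothesis alphaI : fpf_involution alpha.

(** Such colorings correspond, through [h], to arbitrary functions on the set of component roots. *)
Lemma card_const_on_comp (e : rel V) (k : nat) : connect_sym e ->
  #|[set c : {ffun V -> 'I_k} | [forall x, forall y, e x y ==> (c x == c y)]]| = (k ^ ncomp e)%N.
Proof.
move=> se; pose S := fingraph.root e @: [set: V].
pose h (g : {ffun {x | x \in S} -> 'I_k}) : {ffun V -> 'I_k} :=
  [ffun x => g (exist _ (fingraph.root e x) (imset_f _ (in_setT x)))].
have hinj : injective h.
  move=> g g' /ffunP gg'; apply/ffunP=> -[x xS].
  have [y _ xy] := imsetP xS; have := gg' y; rewrite !ffunE.
  by congr (g _ = g' _); apply: val_inj.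
have -> : (k ^ ncomp e)%N = #|h @: [set: {ffun {x | x \in S} -> 'I_k}]|.
  by rewrite card_imset // cardsT card_ffun card_ord card_sig.
congr #|pred_of_set _|; apply/setP=> c; rewrite inE; apply/idP/imsetP.
  move=> /forallP cst.
  have cstc x y : connect e x y -> c x = c y.
    case/connectP=> p; elim: p x => [|z p IH] x /=; first by move=> _ ->.
    by case/andP=> /(implyP (forallP (cst x) z))/eqP-> /IH{}IH /IH.
  exists [ffun x => c (val x)] => //; apply/ffunP=> x; rewrite !ffunE /=.
  exact/cstc/connect_root.
case=> g _ ->; apply/forallP=> x; apply/forallP=> y; apply/implyP=> /connect1 xy.
rewrite !ffunE; apply/eqP; congr (g _); apply: val_inj; exact/(fingraph.rootP se).
Qed.

Let mono k (c : {ffun V -> 'I_k}) (e : {set D}) :=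
  [exists d in e, c (vert d) == c (vert (alpha d))].

Let mono_porbit k (c : {ffun V -> 'I_k}) d :
  mono c (porbit alpha d) = (c (vert d) == c (vert (alpha d))).
Proof.
apply/existsP/idP => [[x]|dd]; last by exists d; rewrite porbit_id.
rewrite porbit_edge // !inE => /andP[/orP[]/eqP-> //].
by rewrite (alphaI d).1 eq_sym.
Qed.

(** Inclusion-exclusion over the monochromatic edges; a loop is always monochromatic and makes every
    product vanish. After exchanging sums, each [B] counts the colorings constant on its
    components. *)
Lemma proper_colorings_expand k :
  (proper_colorings vert alpha k)%:Z =
  \sum_(B : {set {set D}} | B \subset porbits alpha) (-1) ^+ #|B| * k%:Z ^+ kcomp alpha vert B.
Proof.
transitivity (\sum_(c : {ffun V -> 'I_k}) \prod_(e in porbits alpha) (1 - (mono c e)%:R : int)).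
  rewrite -natz /proper_colorings -sum1_card natr_sum big_mkcond /=; apply: eq_bigr => c _.
  rewrite inE; case: ifP => [/forallP nc|/negbT/forallPn[d]].
    by rewrite big1 // => _ /imsetP[d _ ->]; rewrite mono_porbit (negbTE (nc d)) subr0.
  rewrite negbK => cd.
  by rewrite (bigD1 (porbit alpha d)) ?imset_f //= mono_porbit cd subrr mul0r.
under eq_bigr do rewrite prod_subset_expand.
rewrite exchange_big /=; apply: eq_bigr => B sB; rewrite -mulr_sumr; congr (_ * _).
rewrite -natz -natrX -card_const_on_comp; last exact: sub_adj_sym.
rewrite -sum1_card natr_sum [RHS]big_mkcond /=; apply: eq_bigr => c _.
rewrite inE; case: ifP => [cst|/negbT/forallPn[x /forallPn[y]]].
  rewrite big1 // => e eB; have /imsetP[d _ ed] := subsetP sB e eB.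
  rewrite ed mono_porbit (_ : _ == _) //.
  move/forallP/(_ (vert d))/forallP/(_ (vert (alpha d)))/implyP: cst; apply.
  by apply/existsP; exists d; rewrite -ed eB !eqxx.
rewrite negb_imply => /andP[/existsP[d /and3P[dB /eqP<- /eqP<-]] cd].
by rewrite (bigD1 (porbit alpha d)) //= mono_porbit (negbTE cd) mul0r.
Qed.

(** The difference of the two sides vanishes at [0, ..., size r - 1], more roots than a nonzero
    polynomial of that size can have. *)
Lemma chromatic_poly_expand (p : {poly int}) :
  (forall k : nat, p.[k%:Z] = (proper_colorings vert alpha k)%:Z) ->
  p = \sum_(B : {set {set D}} | B \subset porbits alpha) (-1) ^+ #|B| * 'X^(kcomp alpha vert B).
Proof.
move=> pE; apply/eqP; rewrite -subr_eq0; apply/eqP.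
set r := _ - _.
apply: (@roots_geq_poly_eq0 _ r [seq k%:Z | k <- iota 0 (size r)]).
- apply/allP=> _ /mapP[k _ ->]; apply/rootP.
  rewrite hornerD hornerN pE proper_colorings_expand horner_sum.
  apply/eqP; rewrite subr_eq0; apply/eqP/eq_bigr => B _.
  by rewrite hornerM horner_exp hornerN hornerC hornerXn.
- by rewrite map_inj_uniq ?iota_uniq // => i j [].
- by rewrite size_map size_iota.
Qed.

End Chromatic.

(** * Truncated Laurent series *)

Lemma lcoefz_lt (x : laurent) m : m < lval x -> lcoefz x m = 0.
Proof. by move=> mx; rewrite /lcoefz leNgt mx. Qed.

(** The offsets [a] and [b] need only be lower bounds for the valuations, so that series can be
    compared from a common starting exponent. *)
Lemma lcoefz_mul (x y : laurent) (a b : int) (n : nat) :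
  a <= lval x -> b <= lval y ->
  lcoefz (ls_mul x y) (n%:Z + (a + b))
  = \sum_(i < n.+1) lcoefz x (i%:Z + a) * lcoefz y ((n - i)%N%:Z + b).
Proof.
(* Each factor is replaced by a shifted polynomial; cutting at [n.+1] loses nothing, since only
   indices up to [n] enter the convolution. *)
have tr (z : laurent) (c : int) (i : nat) : c <= lval z -> (i <= n)%N ->
    lcoefz z (i%:Z + c) = ('X^`|(lval z - c)%R|%N * \poly_(j < n.+1) lcoef z j)`_i.
  move=> cz le_in; rewrite coefXnM coef_poly /lcoefz.
  case: ifP => h; case: ifP => h'; try lia.
  by rewrite ifT; [congr lcoef; lia | lia].
move=> ax yb.
under eq_bigr => i _ do rewrite (tr x a) ?leq_ord ?leq_subr // (tr y b) ?leq_subr //.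
rewrite -coefM mulrACA -exprD coefXnM /lcoefz /=.
case: ifP => h; case: ifP => h'; try lia.
rewrite coefM; set r := (n - _)%N; have -> : absz (n%:Z + (a + b) - (lval x + lval y))%R = r by lia.
apply: eq_bigr => i _; have := ltn_ord i; rewrite {2}/r ltnS => ir.
by rewrite !coef_poly !ifT //; lia.
Qed.

(* [x] agrees with [q^-K * p(q)] up to, but excluding, [q^(M-K)]. *)
Definition approx (K M : nat) (p : {poly int}) (x : laurent) : Prop :=
  - K%:Z <= lval x /\ forall n : nat, (n < M)%N -> lcoefz x (n%:Z - K%:Z) = p`_n.

(** The precision [M] is counted from the lowest exponent, so it survives multiplication while the
    pole bounds add. *)
Lemma approx_mul K L M p r x y :
  approx K M p x -> approx L M r y -> approx (K + L) M (p * r) (ls_mul x y).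
Proof.
case=> vx px [vy ry]; split; first by rewrite /=; lia.
move=> n nM; rewrite PoszD opprD lcoefz_mul // coefM; apply: eq_bigr => i _.
rewrite px ?ry //; [exact: leq_ltn_trans (leq_subr _ _) nM | exact: leq_trans (ltn_ord i) nM].
Qed.

Lemma approx_add K M p r x y :
  approx K M p x -> approx K M r y -> approx K M (p + r) (ls_add x y).
Proof.
case=> vx px [vy ry]; split; first by rewrite /= le_min vx.
move=> n nM; rewrite coefD -px // -ry // /lcoefz /=.
case: ifP => h.
  rewrite -!/(lcoefz _ _).
  by congr (lcoefz _ _ + lcoefz _ _); lia.
rewrite -!/(lcoefz _ _) !lcoefz_lt ?addr0 //; lia.
Qed.

Lemma approx_mono K M (j : int) : - K%:Z <= j -> approx K M 'X^`|(j + K%:Z)%R|%N (ls_mono j).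
Proof.
move=> Kj; split=> // n _; rewrite coefXn /lcoefz /=.
case: ifP => h.
  by case: eqP => h1; case: eqP => h2; try lia.
by case: eqP => //; lia.
Qed.

Lemma approx_const K M c : approx K M (c%:P * 'X^K) (ls_const c).
Proof.
split; first by rewrite /=; lia.
move=> n _; rewrite coefCM coefXn /lcoefz /=.
by case: ifP => h; repeat case: eqP => ?; rewrite ?mulr1 ?mulr0 //; lia.
Qed.

Lemma approx_exp K M p x n : approx K M p x -> approx (n * K) M (p ^+ n) (ls_exp x n).
Proof.
move=> px; elim: n => [|n IH]; first by have := approx_const 0 M 1; rewrite mulr1.
by rewrite mulSn exprS; apply: approx_mul.
Qed.

Lemma approx_sum K M (A : eqType) (s : seq A) P (F : A -> laurent) :
  {in s, forall a, approx K M (P a) (F a)} ->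
  approx K M (\sum_(a <- s) P a) (ls_sum (map F s)).
Proof.
elim: s => [|a s IH] sP; first by rewrite big_nil; have := approx_const K M 0; rewrite mul0r.
rewrite big_cons; apply: approx_add; first by apply: sP; rewrite mem_head.
by apply: IH => b bs; apply: sP; rewrite in_cons bs orbT.
Qed.

Lemma approx_inj K M p x y m : approx K M p x -> approx K M p y ->
  m < M%:Z - K%:Z -> lcoefz x m = lcoefz y m.
Proof.
case=> vx px [vy py] mM; case: (ltP m (- K%:Z)) => mK.
  by rewrite !lcoefz_lt //; lia.
have -> : m = (absz (m + K%:Z)%R)%:Z - K%:Z by lia.
by rewrite px ?py //; lia.
Qed.

Local Notation qpoly := (1 + 'X^2 : {poly int}).

Lemma approx_qint2 M : approx 1 M qpoly qint2.
Proof.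
apply: approx_add; first exact: (approx_mono M (K := 1) (j := -1)).
exact: (approx_mono M (K := 1) (j := 1)).
Qed.

Lemma approx_qint2_exp M k : approx k M (qpoly ^+ k) (ls_exp qint2 k).
Proof. by have := approx_exp k (approx_qint2 M); rewrite muln1. Qed.

(** The term of degree [i] has a pole of order at most [2 * i]; the padding ['X^(2 * (L - i))]
    brings all terms to the common denominator [q^(2L)]. *)
Lemma approx_horner M L (s : seq int) : (size s <= L)%N ->
  approx (2 * L) M
    (\sum_(i < L) (s`_i)%:P * (qpoly ^+ (2 * i) * 'X^(2 * (L - i))))
    (foldr (fun c acc => ls_add (ls_const c) (ls_mul (ls_exp qint2 2) acc)) ls_zero s).
Proof.
elim: s L => [|c s IH] L.
  move=> _; rewrite big1 => [|i _]; last by rewrite nth_nil mul0r.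
  by have := approx_const (2 * L) M 0; rewrite mul0r.
case: L => // L sL; rewrite big_ord_recl /= subn0 mul1r.
apply: approx_add; first exact: approx_const.
rewrite mulnS; set S := \sum_(i < L) _.
have -> : S = qpoly ^+ 2 *
    \sum_(i < L) (s`_i)%:P * (qpoly ^+ (2 * i) * 'X^(2 * (L - i))).
  rewrite mulr_sumr; apply: eq_bigr => i _.
  by rewrite /bump /= add1n subSS mulnS exprD; ring.
exact: approx_mul (approx_qint2_exp M 2) (IH L sL).
Qed.

(** * Convergence of the graded Euler characteristic *)

Section EulerLimit.
Variables (C : nat -> seq (int * nat)) (K : nat).
Hypothesis C_bound : forall i jk, jk \in C i -> [/\ i%:Z <= jk.1 & (jk.2 <= K)%N].

(** This is [q^K] times the degree [i] contribution, with [X] for [q]: since [[2]^k = q^-k (1 +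
    q^2)^k], a summand [(j, k)] starts at exponent [j + K - k]. *)
Definition degree_poly i : {poly int} :=
  (-1) ^+ i * \sum_(jk <- C i) 'X^(absz jk.1 + (K - jk.2)) * qpoly ^+ jk.2.

Lemma approx_degree M i : approx K M (degree_poly i)
  (ls_mul (ls_const ((-1) ^+ i)) (ls_sum (map summand_char (C i)))).
Proof.
rewrite -[K in approx K]add0n; apply: approx_mul.
  by have := approx_const 0 M ((-1) ^+ i); rewrite mulr1 rmorphXn rmorphN1.
apply: approx_sum => -[j k] /C_bound[/= ij kK].
rewrite -[K in approx K](subnK kK); apply: approx_mul; last exact: approx_qint2_exp.
have -> : (absz j + (K - k))%N = absz (j + (K - k)%N%:Z)%R by lia.
by apply: approx_mono; lia.
Qed.

Lemma approx_partial M N :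
  approx K M (\sum_(i < N.+1) degree_poly i) (euler_partial C N).
Proof.
rewrite -(big_mkord predT degree_poly) /index_iota subn0.
apply: approx_sum => i _; exact: approx_degree.
Qed.

Lemma coef_degree_poly i n : (n < i)%N -> (degree_poly i)`_n = 0.
Proof.
move=> ni; rewrite /degree_poly -polyC1 -polyCN -polyC_exp coefCM coef_sum big_seq big1 ?mulr0 //.
move=> [j k] /C_bound[/= ij _]; rewrite coefXnM ifT //; lia.
Qed.

Lemma coef_partial N N' n : (n <= N <= N')%N ->
  (\sum_(i < N'.+1) degree_poly i)`_n = (\sum_(i < N.+1) degree_poly i)`_n.
Proof.
case/andP=> nN /subnK<-; elim: (N' - N)%N => // d IH.
rewrite addSn big_ord_recr coefD IH coef_degree_poly ?addr0 //=; lia.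
Qed.

(** The [n]-th coefficient is read off the partial sum up to degree [n], after which it no longer
    changes. *)
Definition euler_limit : laurent :=
  Laurent (- K%:Z) (fun n => (\sum_(i < n.+1) degree_poly i)`_n).

Lemma approx_limit N : approx K N.+1 (\sum_(i < N.+1) degree_poly i) euler_limit.
Proof.
split=> // n nN; rewrite /lcoefz /= ifT; last lia.
have -> : absz (n%:Z - K%:Z - - K%:Z)%R = n by lia.
by rewrite (@coef_partial n N) // leqnn.
Qed.

Lemma euler_limitP : is_euler_char C euler_limit.
Proof.
move=> m; exists (absz (m + K%:Z)%R) => N mN.
apply: approx_inj (approx_limit N) (approx_partial _ N) _; lia.
Qed.

End EulerLimit.

(** * The state sum *)

Definition eqmodX (M : nat) (p r : {poly int}) : Prop := exists t, p = r + 'X^M * t.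

Lemma eqmodX_refl M p : eqmodX M p p.
Proof. by exists 0; rewrite mulr0 addr0. Qed.

Lemma eqmodX_trans M p r s : eqmodX M p r -> eqmodX M r s -> eqmodX M p s.
Proof. by case=> t -> [t' ->]; exists (t' + t); rewrite mulrDr addrA. Qed.

Lemma eqmodX_mul M p p' r r' :
  eqmodX M p p' -> eqmodX M r r' -> eqmodX M (p * r) (p' * r').
Proof. by case=> t -> [t' ->]; exists (p' * t' + t * r' + 'X^M * t * t'); ring. Qed.

Lemma eqmodX_exp M p r n : eqmodX M p r -> eqmodX M (p ^+ n) (r ^+ n).
Proof.
move=> pr; elim: n => [|n IH]; first exact: eqmodX_refl.
by rewrite !exprS; apply: eqmodX_mul.
Qed.

Lemma eqmodX_sum M (I : finType) (P : pred I) (F G : I -> {poly int}) :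
  (forall i, P i -> eqmodX M (F i) (G i)) ->
  eqmodX M (\sum_(i | P i) F i) (\sum_(i | P i) G i).
Proof.
move=> FG; apply: (big_ind2 (eqmodX M)) => //; first exact: eqmodX_refl.
by move=> p p' r r' [t ->] [t' ->]; exists (t + t'); ring.
Qed.

Lemma eqmodX_coef M p r n : eqmodX M p r -> (n < M)%N -> p`_n = r`_n.
Proof. by case=> t -> nM; rewrite coefD coefXnM nM addr0. Qed.

Section StateSum.
Variables (D : finType) (alpha : {perm D}) (F : {set {set D}} -> nat) (K : nat).
Implicit Type m : {set D} -> nat.

Let E := porbits alpha.

Definition supp m : {set {set D}} := [set e in E | m e != 0%N].
Definition total m : nat := (\sum_(e in E) m e)%N.
(** For [m e = 0] the truncated predecessor gives [0], in agreement with [P2_obj]. *)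
Definition shift m : nat := (\sum_(e in E) (m e).*2.-1)%N.

Definition state_poly m : {poly int} :=
  (-1) ^+ total m * ('X^(shift m + (K - F (supp m))) * qpoly ^+ F (supp m)).

Lemma eq_state_poly m m' : m =1 m' -> state_poly m = state_poly m'.
Proof.
move=> mm'; have sE : supp m = supp m' by apply/setP=> e; rewrite !inE mm'.
rewrite /state_poly sE; congr ((-1) ^+ _ * ('X^(_ + _) * _)); apply: eq_bigr => e _; by rewrite mm'.
Qed.

Lemma total_le_shift m : (total m <= shift m)%N.
Proof. by apply: leq_sum => e _; case: (m e) => // n; rewrite doubleS -addnn; lia. Qed.

Definition off_zero m := [forall e, (e \notin E) ==> (m e == 0%N)].

Lemma off_zero_le_total m e : off_zero m -> (m e <= total m)%N.
Proof.
move/forallP/(_ e); case: (boolP (e \in E)) => [eE _|_ /eqP-> //].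
by rewrite /total (bigD1 e) //= leq_addr.
Qed.

Lemma eq_off_zero m m' : m =1 m' -> off_zero m = off_zero m'.
Proof. by move=> mm'; apply: eq_forallb => e; rewrite mm'. Qed.

Lemma eq_total m m' : m =1 m' -> total m = total m'.
Proof. by move=> mm'; apply: eq_bigr => e _; rewrite mm'. Qed.

(** Every entry of a state of total [i] is at most [i], so enlarging the range to ['I_N.+1] adds no
    state. All degrees thus share one index type. *)
Lemma degree_states_reindex N i : (i <= N)%N ->
  \sum_(n : {ffun {set D} -> 'I_i.+1} | off_zero (val \o n) && (total (val \o n) == i))
    state_poly (val \o n)
  = \sum_(n : {ffun {set D} -> 'I_N.+1} | off_zero (val \o n) && (total (val \o n) == i))
    state_poly (val \o n).
Proof.
move=> iN.
pose h (n : {ffun {set D} -> 'I_N.+1}) : {ffun {set D} -> 'I_i.+1} := [ffun e => inord (n e)].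
pose h' (n : {ffun {set D} -> 'I_i.+1}) : {ffun {set D} -> 'I_N.+1} := [ffun e => inord (n e)].
have h'E n : val \o h' n =1 val \o n.
  by move=> e; rewrite /= ffunE inordK // (leq_trans (ltn_ord _)).
rewrite (reindex_onto h h') => [|n _]; last first.
  by apply/ffunP=> e; apply: val_inj; rewrite ffunE -[n e]inord_val; congr inord; have := h'E n e.
have hE n : h' (h n) == n -> val \o h n =1 val \o n.
  by move=> /eqP hn e; rewrite -h'E hn.
apply: eq_big => n; last by case/andP=> _ /hE/eq_state_poly.
apply/idP/idP => [/andP[]|/andP[oz /eqP tn]].
  by move=> h1 /hE hn; rewrite (eq_off_zero hn) (eq_total hn) in h1.
have hn : h' (h n) == n.
  apply/eqP/ffunP=> e; rewrite !ffunE -[RHS]inord_val; congr inord.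
  by rewrite inordK // ltnS -tn; exact: off_zero_le_total oz.
by rewrite hn (eq_off_zero (hE _ hn)) (eq_total (hE _ hn)) oz tn eqxx.
Qed.

(** The product telescopes. The sum [- X + X^3 - ...] truncates [- 1/[2]], the coefficient of [e_1]
    in the class of [P_2]. *)
Lemma geom_trunc N :
  qpoly * (\sum_(j < N.+1 | j != 0%N :> nat) (-1) ^+ j * 'X^(j.*2.-1))
  = - 'X + (-1) ^+ N * 'X^(N.*2.+1).
Proof.
elim: N => [|N IH].
  by rewrite big1 ?mulr0 => [|j]; [rewrite expr1; ring | rewrite (ord1 j)].
rewrite big_mkcond big_ord_recr -big_mkcond /= mulrDr IH doubleS /= !exprS; ring.
Qed.

(** States are grouped by support. In the full box the degrees on distinct edges are independent, so
    each sum factors over edges; an edge outside [B] contributes only its term [j = 0], which is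
    [1]. *)
Lemma box_sum N :
  \sum_(n : {ffun {set D} -> 'I_N.+1} | off_zero (val \o n)) state_poly (val \o n)
  = \sum_(B : {set {set D}} | B \subset E) ('X^(K - F B) * qpoly ^+ F B) *
      (\sum_(j < N.+1 | j != 0%N :> nat) (-1) ^+ j * 'X^(j.*2.-1)) ^+ #|B|.
Proof.
rewrite (partition_big (fun n : {ffun {set D} -> 'I_N.+1} => supp (val \o n))
           (fun B : {set {set D}} => B \subset E)) /=; last first.
  by move=> n _; apply/subsetP=> e; rewrite inE => /andP[].
apply: eq_bigr => B sB.
pose Q (e : {set D}) (j : 'I_N.+1) := (e \in B) == (j != 0%N :> nat).
transitivity (\sum_(n in family Q) ('X^(K - F B) * qpoly ^+ F B) *
   \prod_e ((-1) ^+ n e * 'X^((n e).*2.-1) : {poly int})).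
  apply: eq_big => n.
    apply/andP/familyP => [[/forallP oz /eqP sn] e|fn].
      rewrite unfold_in /Q -sn inE /=; case: (boolP (e \in E)) => //= eE.
      by have := implyP (oz e) eE; rewrite /= => ->.
    split; last first.
      apply/eqP/setP=> e; rewrite inE /=.
      have := fn e; rewrite unfold_in /Q => /eqP<-.
      by apply/andP/idP => [[]//|eB]; split=> //; apply: (subsetP sB).
    apply/forallP=> e; apply/implyP=> eE /=.
    have := fn e; rewrite unfold_in /Q (negbTE (contra (subsetP sB e) eE)).
    by rewrite eq_sym eqbF_neg negbK.
  case/andP=> oz /eqP sn; rewrite /state_poly sn exprD /total /shift.
  rewrite (_ : \prod_e _ = \prod_(e in E) ((-1) ^+ n e * 'X^((n e).*2.-1))); last first.
    rewrite [RHS]big_mkcond; apply: eq_bigr => e _; case: ifP => // /negbT eE.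
    by have /eqP /= -> := implyP (forallP oz e) eE; rewrite mulr1.
  rewrite big_split /= !expr_sum.
  move: (\prod_(_ in _) _) (\prod_(_ in _) _) ('X^_) (qpoly ^+ _) => a b c d; ring.
rewrite -mulr_sumr -(bigA_distr_big_dep Q (fun _ (j : 'I_N.+1) => (-1) ^+ j * 'X^(j.*2.-1))).
congr (_ * _).
rewrite -prodr_const [RHS]big_mkcond; apply: eq_bigr => e _; rewrite /Q; case: (e \in B) => /=.
  by apply: eq_bigl => j; rewrite eq_sym eqb_id.
rewrite (big_pred1 ord0) ?mulr1 // => j; by rewrite eq_sym eqbF_neg negbK.
Qed.

(** The extra states of the box have total above [N], hence shift above [N], and are divisible by
    ['X^N.+1]. *)
Lemma partial_states_mod N :
  eqmodX N.+1
   (\sum_(n : {ffun {set D} -> 'I_N.+1} | off_zero (val \o n) && (total (val \o n) < N.+1)%N)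
      state_poly (val \o n))
   (\sum_(n : {ffun {set D} -> 'I_N.+1} | off_zero (val \o n)) state_poly (val \o n)).
Proof.
rewrite [X in eqmodX _ X _]big_mkcondr /=; apply: eqmodX_sum => n _.
case: ltnP => [_|tn]; first exact: eqmodX_refl.
have [d dE] : exists d, shift (val \o n) = (N.+1 + d)%N.
  exists (shift (val \o n) - N.+1)%N; rewrite subnKC //.
  exact: leq_trans tn (total_le_shift _).
exists (- ((-1) ^+ total (val \o n) * ('X^(d + (K - F (supp (val \o n))))
        * qpoly ^+ F (supp (val \o n))))).
rewrite /state_poly dE -addnA exprD.
by rewrite mulrN -mulrA mulrCA subrr.
Qed.

Lemma sum_states_degree N :
  \sum_(i < N.+1)
     \sum_(n : {ffun {set D} -> 'I_i.+1} | off_zero (val \o n) && (total (val \o n) == i))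
    state_poly (val \o n)
  = \sum_(n : {ffun {set D} -> 'I_N.+1} | off_zero (val \o n) && (total (val \o n) < N.+1)%N)
      state_poly (val \o n).
Proof.
under eq_bigr => i _ do rewrite (degree_states_reindex (N := N)) ?leq_ord //.
rewrite (partition_big (fun n : {ffun {set D} -> 'I_N.+1} =>
           inord (total (val \o n)) : 'I_N.+1) predT) //=.
apply: eq_bigr => i _; apply: eq_bigl => n; rewrite -andbA; congr (_ && _).
apply/eqP/andP => [->|[tn /eqP<-]]; last by rewrite inordK.
by rewrite ltn_ord inord_val.
Qed.

End StateSum.

Lemma approx_coef K M (p r : {poly int}) x : (forall n, (n < M)%N -> p`_n = r`_n) ->
  approx K M p x -> approx K M r x.
Proof. by move=> pr [vx px]; split=> // n nM; rewrite px // pr. Qed.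

(** * Comparison of the spin-network state sum with the Whitney expansion *)

Section SpinEuler.
Variables (V W D : finType) (vert : D -> V) (sigma alpha : {perm D}).
Variables (wvert : D -> W) (tau : {perm D}).
Hypothesis alphaI : fpf_involution alpha.
Hypothesis rot : is_rotation vert sigma.
Hypothesis conn : graph_connected vert alpha.
Hypothesis plane : plane_embedded V sigma alpha.
Hypothesis dual : is_planar_dual V sigma alpha wvert tau.

Let k B := kcomp alpha vert B.
(** [L] exceeds the degree of the chromatic polynomial and [K] bounds the number of circles;
    [2 * L = #|V| + K] gives both sides of the identity the same denominator. *)
Let L := (#|V| + (nedges alpha).+1)%N.
Let K := (#|V| + 2 * (nedges alpha).+1)%N.
Let F (B : {set {set D}}) := (#|B| + 2 * k B - #|V|)%N.

Lemma kcomp_le B : (k B <= #|V|)%N.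
Proof. exact: ncomp_le. Qed.

Lemma ncirclesF (B : {set {set D}}) : B \subset porbits alpha ->
  [/\ (F B + #|V| = #|B| + 2 * k B)%N, (F B <= K)%N & (K - F B + #|B| = 2 * (L - k B))%N].
Proof.
move=> sB.
(* Counting circles for the state with [e_1] exactly on [B] shows that the subtraction in [F] is not
   truncated. *)
have := ncircles_plane alphaI rot conn plane dual
  (st := fun e => if e \in B then TLe1 else TLid) sB.
have stB d : (porbit alpha d \in B) =
    (if (if porbit alpha d \in B then TLe1 else TLid) is TLe1 then true else false).
  by case: (_ \in B).
move/(_ stB); rewrite -/(k B).
have := subset_leq_card sB; rewrite -/(nedges alpha).
have := kcomp_le B; rewrite /F /K /L.
move: #|V| (nedges _) #|B| (k B) (ncircles _ _ _ _) => v e b kB c.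
by move=> h1 h2 h3; split; lia.
Qed.

Lemma ncircles_state i (n : {ffun {set D} -> 'I_i.+1}) :
  ncircles wvert tau alpha (state_diagram n) = F (supp alpha (val \o n)).
Proof.
have sB : supp alpha (val \o n) \subset porbits alpha.
  by apply/subsetP=> e; rewrite inE => /andP[].
have := ncircles_plane alphaI rot conn plane dual (st := state_diagram n) sB.
have stB d : (porbit alpha d \in supp alpha (val \o n)) =
    (if state_diagram n (porbit alpha d) is TLe1 then true else false).
  by rewrite inE imset_f //= /state_diagram /=; case: (nat_of_ord _).
move/(_ stB); rewrite /F -/(k _).
move: #|V| #|supp _ _| (k _) (ncircles _ _ _ _) => v b kB c; lia.
Qed.

Lemma state_shiftE i (n : {ffun {set D} -> 'I_i.+1}) :
  state_shift alpha n = (shift alpha (val \o n))%:Z.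
Proof.
rewrite /state_shift /shift (big_morph Posz PoszD (erefl _)); apply: eq_bigr => e _.
by rewrite /=; case: (nat_of_ord _).
Qed.

Lemma mem_degree_states i (n : {ffun {set D} -> 'I_i.+1}) :
  (n \in degree_states alpha i)
  = off_zero alpha (val \o n) && (total alpha (val \o n) == i).
Proof. by rewrite mem_enum inE. Qed.

Lemma spin_chain_bound i jk : jk \in spin_chain wvert tau alpha i ->
  [/\ i%:Z <= jk.1 & (jk.2 <= K)%N].
Proof.
case/mapP=> n; rewrite mem_degree_states => /andP[_ /eqP tn] ->.
rewrite /= state_shiftE ncircles_state; split.
  by rewrite lez_nat -{1}tn total_le_shift.
by case: (@ncirclesF (supp alpha (val \o n))) => //; apply/subsetP=> e; rewrite inE => /andP[].
Qed.

Lemma degree_poly_spin i : degree_poly (spin_chain wvert tau alpha) K i =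
  \sum_(n : {ffun {set D} -> 'I_i.+1}
         | off_zero alpha (val \o n) && (total alpha (val \o n) == i))
    state_poly alpha F K (val \o n).
Proof.
rewrite /degree_poly /spin_chain big_map /degree_states big_enum /= mulr_sumr.
apply: eq_big => n; first by rewrite inE.
rewrite inE => /andP[_ /eqP tn].
by rewrite state_shiftE ncircles_state /state_poly (_ : total alpha (val \o n) = i).
Qed.

Lemma state_sum_chromatic N :
  eqmodX N.+1
    (qpoly ^+ #|V| * \sum_(i < N.+1) degree_poly (spin_chain wvert tau alpha) K i)
    (\sum_(B : {set {set D}} | B \subset porbits alpha)
        (-1) ^+ #|B| * (qpoly ^+ (2 * k B) * 'X^(2 * (L - k B)))).
Proof.
under eq_bigr => i _ do rewrite degree_poly_spin.
rewrite sum_states_degree.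
apply: eqmodX_trans (eqmodX_mul (eqmodX_refl _ _) (partial_states_mod _ _ _ _)) _.
rewrite box_sum mulr_sumr; apply: eqmodX_sum => B sB.
have [FV _ FK] := ncirclesF sB; set w := \sum_(j < N.+1 | _) _.
(* The prefactor turns the exponent [F B] into [#|B| + 2 * k B]; the [#|B|] extra factors are paired
   with the copies of [w]. *)
have -> : qpoly ^+ #|V| * ('X^(K - F B) * qpoly ^+ F B * w ^+ #|B|)
        = 'X^(K - F B) * qpoly ^+ (2 * k B) * (qpoly * w) ^+ #|B|.
  rewrite exprMn.
  transitivity ('X^(K - F B) * qpoly ^+ (F B + #|V|) * w ^+ #|B|).
    have aux (a x c y : {poly int}) : a * (x * c * y) = x * (c * a) * y by ring.
    by rewrite exprD aux.
  have aux (a x c y : {poly int}) : x * (a * c) * y = x * c * (a * y) by ring.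
  by rewrite FV exprD aux.
have -> : (-1) ^+ #|B| * (qpoly ^+ (2 * k B) * 'X^(2 * (L - k B)))
        = 'X^(K - F B) * qpoly ^+ (2 * k B) * (- 'X) ^+ #|B|.
  have aux (s c x y : {poly int}) : s * (c * (x * y)) = x * c * (s * y) by ring.
  by rewrite -FK exprD [in RHS]exprNn aux.
apply: eqmodX_mul; first exact: eqmodX_refl.
(* The error term [X^(2N+1)] of the truncated geometric sum is split as [X^(N+1) X^N]. *)
apply: eqmodX_exp; exists ((-1) ^+ N * 'X^N).
by rewrite geom_trunc mulrCA -exprD addSn addnn.
Qed.

Lemma approx_chromatic M (p : {poly int}) :
  (forall j : nat, p.[j%:Z] = (proper_colorings vert alpha j)%:Z) ->
  approx (2 * L) M
    (\sum_(B : {set {set D}} | B \subset porbits alpha)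
        (-1) ^+ #|B| * (qpoly ^+ (2 * k B) * 'X^(2 * (L - k B))))
    (ls_horner p (ls_exp qint2 2)).
Proof.
move=> /(chromatic_poly_expand alphaI) pE.
have kL B : (k B < L)%N by rewrite /L addnS ltnS (leq_trans (kcomp_le B)) ?leq_addr.
(* Coefficientwise, each [B] contributes only in degree [k B]; this bounds the size of [p] and later
   collapses the sum over [i]. *)
have pj j : p`_j = \sum_(B : {set {set D}} | B \subset porbits alpha) (-1) ^+ #|B| * (j == k B)%:R.
  rewrite pE coef_sum; apply: eq_bigr => B _.
  by rewrite -polyC1 -polyCN -polyC_exp coefCM coefXn.
have sp : (size p <= L)%N.
  apply/leq_sizeP=> j Lj; rewrite pj big1 // => B _.
  by rewrite gtn_eqF ?mulr0 // (leq_trans (kL B)).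
have := approx_horner M sp; rewrite -/(ls_horner p _).
set S := \sum_(i < L) _; set S' := \sum_(B | _) _.
have -> // : S = S'.
rewrite /S; under eq_bigr => i _ do rewrite pj rmorph_sum mulr_suml.
rewrite exchange_big /=; apply: eq_bigr => B _.
rewrite (bigD1 (Ordinal (kL B))) //= eqxx mulr1 big1 ?addr0.
  by rewrite rmorphXn rmorphN1.
by move=> i; rewrite -val_eqE /= => /negbTE->; rewrite mulr0 mul0r.
Qed.

End SpinEuler.

Theorem mainTheorem5
  (V W D : finType) (vert : D -> V) (sigma alpha : {perm D})
  (wvert : D -> W) (tau : {perm D}) (chiG : {poly int}) :
  fpf_involution alpha ->
  is_rotation vert sigma ->
  graph_connected vert alpha ->
  plane_embedded V sigma alpha ->
  is_planar_dual V sigma alpha wvert tau ->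
  (forall k : nat, chiG.[k%:Z] = (proper_colorings vert alpha k)%:Z) ->
  exists X : laurent,
    is_euler_char (spin_chain wvert tau alpha) X /\
    ls_eq (ls_horner chiG (ls_exp qint2 2))
          (ls_mul (qint2_powz (2 + ((\sum_(w : W) ((valence wvert w)%:Z - 2)) %/ 2)%Z))
                  X).
Proof.
move=> alphaI rot conn plane dual chi.
set C := spin_chain wvert tau alpha.
have Cb := spin_chain_bound alphaI rot conn plane dual.
set K := (#|V| + 2 * (nedges alpha).+1)%N in Cb.
exists (euler_limit C K); split; first exact: euler_limitP Cb.
rewrite (prefactor_exponent alphaI plane dual) /= => m.
(* Precision [N.+1] with pole order [#|V| + K] covers the exponents below [N + 1 - (#|V| + K)], and
   so covers [m]. *)
pose N := absz (m + (#|V| + K)%N%:Z)%R.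
have lhs := approx_chromatic alphaI N.+1 chi.
have rhs := approx_mul (approx_qint2_exp N.+1 #|V|) (approx_limit Cb N).
have KL : (2 * (#|V| + (nedges alpha).+1) = #|V| + K)%N by rewrite /K; lia.
rewrite KL in lhs.
apply: approx_inj lhs (approx_coef _ rhs) _; last by rewrite /N; lia.
move=> n nN; rewrite /C /K.
exact: eqmodX_coef (state_sum_chromatic alphaI rot conn plane dual N) nN.
Qed.
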